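(* Let $X$ be a set of alternatives with $|X| = m = 4$ and let $N=\{1,\dots,n\}$ with $n\ge 2$. Let $G: L(X)^N \to 2^X\setminus\{\varnothing\}$ be a social choice correspondence satisfying all of: (1) the Pareto condition; (2) tops-in; (3) balancedness; (4) strong monotonicity. Then $G = G_P$, the Pareto correspondence.
   Context: $X$ is a finite set of alternatives with $|X|=m$, and $N=\{1,\dots,n\}$ is the set of individuals. $L(X)$ is the set of all (strong) orderings on $X$, i.e. complete, asymmetric, transitive relations (strict linear orders; no non-trivial indifference). For an ordering $r$, $r[1]$ denotes its top-ranked element. A profile is an element $u=(u(1),\dots,u(n))$ of $L(X)^N$; write $x\succ_i^u y$ if $x$ ranks above $y$ in $u(i)$. A social choice correspondence is a map $G$ from $L(X)^N$ to the non-empty subsets of $X$. At profile $u$, $x$ Pareto dominates $y$ if $x\succ_i^u y$ for all $i\in N$. The Pareto correspondence is $G_P(u)=\{x\in X: \text{no } y\in X \text{ Pareto dominates } x \text{ at } u\}$. Pareto condition: for all $x,y\in X$ and all profiles $u$, if $x$ Pareto dominates $y$ at $u$ then $y\notin G(u)$. Tops-in: $T(u)\subseteq G(u)$ for all profiles $u$, where $T(u)=\{x\in X: x=u(i)[1] \text{ for some } i\in N\}$. Balancedness: profile $v$ is constructed from profile $u$ by transposition pair $(x,y)$ via individuals $i$ and $j$ if at $u$, $x$ is immediately above $y$ for $i$ and $y$ is immediately above $x$ for $j$, and $v$ is the same as $u$ except that $x$ and $y$ are transposed for $i$ and for $j$. $G$ is balanced if, for all $x,y,u,v,i,j$, whenever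 $v$ is constructed from $u$ by transposition pair $(x,y)$ via individuals $i$ and $j$, then $G(v)=G(u)$. Strong monotonicity: for every $x\in X$, $i\in N$ and every profile $u$, if $x\in G(u)$ and profile $u'$ is constructed from $u$ by raising $x$ in $i$'s ordering and leaving everything else unchanged (the relative order of the other alternatives for $i$, and all other individuals' orderings, are unchanged), then $x\in G(u')\subseteq G(u)$. *)

(* Defs.v *)
From HB Require Import structures.
From mathcomp Require Import all_boot all_order all_fingroup.

Set Implicit Arguments.
Unset Strict Implicit.
Unset Printing Implicit Defensive.

Section Orderings.

Variable X : finType.

Definition is_ordering (r : {set X * X}) : bool :=
  [&& [forall x, forall y, (x != y) ==> ((x, y) \in r) || ((y, x) \in r)],
      [forall x, forall y, ((x, y) \in r) ==> ((y, x) \notin r)] &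
      [forall x, forall y, forall z,
         ((x, y) \in r) && ((y, z) \in r) ==> ((x, z) \in r)]].

(* L(X), with an ordering stored as its graph: extensionally equal orderings
   are equal, and L(X) is a finite type. *)
Record ordering := Ordering {
  ordering_graph :> {set X * X};
  _ : is_ordering ordering_graph }.

HB.instance Definition _ := [isSub for ordering_graph].
HB.instance Definition _ := [Finite of ordering by <:].

(* x ranks above y in r *)
Definition above (r : ordering) (x y : X) : bool := (x, y) \in ordering_graph r.

(* x = r[1] *)
Definition is_top (r : ordering) (x : X) : bool :=
  [forall y, (y != x) ==> above r x y].

Definition immediately_above (r : ordering) (x y : X) : bool :=
  above r x y && [forall z, ~~ (above r x z && above r z y)].

(* s is r with x and y transposed *)
Definition transposed (x y : X) (r s : ordering) : Prop :=
  forall a b, above s a b = above r (tperm x y a) (tperm x y b).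

(* s is obtained from r by raising x: x moves past at least one alternative,
   loses no alternative it was above, and the others keep their relative
   order. *)
Definition raised (x : X) (r s : ordering) : Prop :=
  [/\ exists2 y, above r y x & above s x y,
      forall y, above r x y -> above s x y
    & forall a b, a != x -> b != x -> above s a b = above r a b].

End Orderings.

Definition profile (X : finType) (n : nat) := {ffun 'I_n -> ordering X}.

Section Correspondences.

Variables (X : finType) (n : nat).
Implicit Types (u v : profile X n) (G : profile X n -> {set X}).

Definition social_choice_correspondence G : Prop := forall u, G u != set0.

Definition pareto_dominates u (x y : X) : bool := [forall i, above (u i) x y].

Definition pareto_correspondence u : {set X} :=
  [set x | ~~ [exists y, pareto_dominates u y x]].

Definition pareto_condition G : Prop :=
  forall x y u, pareto_dominates u x y -> y \notin G u.

Definition tops u : {set X} := [set x | [exists i, is_top (u i) x]].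

Definition tops_in G : Prop := forall u, tops u \subset G u.

(* The first two conditions force x != y and i != j. *)
Definition transposition_pair (x y : X) (i j : 'I_n) u v : Prop :=
  [/\ immediately_above (u i) x y,
      immediately_above (u j) y x,
      transposed x y (u i) (v i),
      transposed x y (u j) (v j)
    & forall k, k != i -> k != j -> v k = u k].

Definition balanced G : Prop :=
  forall x y u v i j, transposition_pair x y i j u v -> G v = G u.

Definition strongly_monotone G : Prop :=
  forall x i u u',
    x \in G u ->
    raised x (u i) (u' i) -> (forall k, k != i -> u' k = u k) ->
    x \in G u' /\ G u' \subset G u.

End Correspondences.

(* Main.v *)
Require Import Defs.
From mathcomp Require Import all_boot.
From mathcomp Require Import perm zify.

(** The inclusion of [G u] in the Pareto set is the Pareto condition.  For the
    converse, let [x] be Pareto optimal at [u].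

    Balancedness and monotonicity combine into a trade ([mem_transfer]).  Suppose
    [y] stands immediately above [x] for voter [i], while voter [j] ranks [x]
    above [y].  Let [x] sink in [j]'s ordering until it is just above [y], then
    transpose [x] and [y] for both voters.  If the final profile selects [x], so
    does [u]: the transposition does not change [G], and undoing the sinking
    raises [x].  So [x] gains one place for [i], at the sole expense of [j].

    Fix a voter [k], and suppose that the alternatives above [x] for [k] can be
    matched with distinct voters, each ranking [x] above the alternative matched
    with it.  Trading them away one by one, the nearest to [x] first, spoils each
    matched voter only once it has been used, and ends with [x] at the top for
    [k], where tops-in applies ([mem_of_distinct_defenders]).

    Pareto optimality matches every [y != x] with some voter ranking [x] above
    [y].  With four alternatives the distinctness comes for free.  Either some
    voter has at most one alternative above [x], so that there is nothing to
    separate; or every voter has at least two above [x], hence at most one below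
    it, and no voter can serve two alternatives. *)

Set Implicit Arguments.
Unset Strict Implicit.
Unset Printing Implicit Defensive.

Section Orderings.

Variable X : finType.
Implicit Types (r s : ordering X) (x y z : X).

Lemma above_total r x y : x != y -> above r x y || above r y x.
Proof.
case: r => g g_ord; case/and3P: (g_ord) => [/forallP tot _ _].
exact: (implyP (forallP (tot x) y)).
Qed.

Lemma above_asym r x y : above r x y -> above r y x = false.
Proof.
case: r => g g_ord; case/and3P: (g_ord) => [_ /forallP asym _] xy; apply: negbTE.
exact: (implyP (forallP (asym x) y)).
Qed.

Lemma above_irr r x : above r x x = false.
Proof. by apply/negP => xx; have := above_asym xx; rewrite xx. Qed.

Lemma above_trans r y x z : above r x y -> above r y z -> above r x z.
Proof.
case: r => g g_ord; case/and3P: (g_ord) => [_ _ /forallP tr] xy yz.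
by apply: (implyP (forallP (forallP (tr x) y) z)); apply/andP.
Qed.

Lemma above_neq r x y : above r x y -> x != y.
Proof. by apply: contraTneq => ->; rewrite above_irr. Qed.

Definition upper_set r x : {set X} := [set y | above r y x].

Definition rank r x : nat := #|upper_set r x|.

Lemma upper_set0_is_top r x : upper_set r x = set0 -> is_top r x.
Proof.
move=> up0; apply/forallP => y; apply/implyP => /(above_total r).
by have := in_set0 y; rewrite -up0 inE => ->.
Qed.

Lemma above_rank r x y : above r x y = (rank r x < rank r y).
Proof.
have mono a b : above r a b -> rank r a < rank r b.
  move=> ab; apply: proper_card; apply/properP; split.
    by apply/subsetP => z; rewrite !inE => za; apply: above_trans ab.
  by exists a; rewrite !inE ?above_irr.
apply/idP/idP; first exact: mono.
have [->|neq] := eqVneq x y; first by rewrite ltnn.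
by case/orP: (above_total r neq) => [//|/mono /ltnW]; rewrite leqNgt => /negP.
Qed.

Lemma rank_inj r : injective (rank r).
Proof.
move=> x y e; apply/eqP; apply: contraT => /(above_total r).
by rewrite !above_rank e ltnn.
Qed.

Lemma ordering_of_score (f : X -> nat) :
  injective f -> {s : ordering X | forall x y, above s x y = (f x < f y)}.
Proof.
move=> f_inj; pose g := [set p : X * X | f p.1 < f p.2].
have g_ord : is_ordering g.
  apply/and3P; split.
  - apply/forallP => x; apply/forallP => y; apply/implyP => xy.
    by rewrite !inE /= -neq_ltn (inj_eq f_inj).
  - apply/forallP => x; apply/forallP => y; apply/implyP.
    by rewrite !inE /= -leqNgt => /ltnW.
  - apply/forallP => x; apply/forallP => y; apply/forallP => z; apply/implyP.
    by rewrite !inE /= => /andP[]; apply: ltn_trans.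
by exists (Ordering g_ord) => x y; rewrite /above inE.
Qed.

Lemma transposed_exists x y r : exists s, transposed x y r s.
Proof.
have [|s sE] := @ordering_of_score (rank r \o tperm x y).
  by apply: inj_comp; [apply: rank_inj | apply: perm_inj].
by exists s => a b; rewrite sE above_rank.
Qed.

(** The doubled ranks leave the odd scores free, so that [x] can be given the one
    just before [y]. *)
Lemma lowered_exists x y r : above r x y ->
  exists2 s, immediately_above s x y & s = r \/ raised x s r.
Proof.
move=> xy; have [imm|] := boolP (immediately_above r x y).
  by exists r => //; left.
rewrite /immediately_above xy /= negb_forall.
case/existsP=> z /negPn/andP[xz zy].
pose f a := if a == x then (rank r y).*2.-1 else (rank r a).*2.
have lt_xy : rank r x < rank r y by rewrite -above_rank.
have f_inj : injective f.
  move=> a b; rewrite /f; case: eqVneq => [->|_]; case: eqVneq => [->|_] //.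
  - by lia.
  - by lia.
  - by move=> e; apply: (@rank_inj r); lia.
have [s sE] := ordering_of_score f_inj.
have neq_yx : (y == x) = false by rewrite eq_sym (negbTE (above_neq xy)).
exists s.
  rewrite /immediately_above sE /f eqxx neq_yx; apply/andP; split; first by lia.
  apply/forallP => a; rewrite !sE /f eqxx neq_yx.
  by apply/negP; case: (a == x) => /andP[]; lia.
right; split.
- exists z => //; rewrite sE /f eqxx eq_sym (negbTE (above_neq xz)).
  by move: zy; rewrite above_rank; lia.
- move=> b; rewrite sE above_rank /f eqxx; case: eqP => _; lia.
- move=> a b /negbTE ax /negbTE bx; rewrite sE above_rank /f ax bx.
  by rewrite ltn_double.
Qed.

Lemma upper_set_transposed x y r s : above r y x -> transposed y x r s ->
  upper_set s x \subset upper_set r x :\ y.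
Proof.
move=> yx tr; apply/subsetP => a; rewrite !inE tr tpermR.
case: tpermP => [->|->|/eqP -> _ ay]; first by rewrite (above_asym yx).
  by rewrite above_irr.
exact: above_trans yx.
Qed.

Lemma upper_set_last x r : upper_set r x != set0 ->
  exists y, immediately_above r y x.
Proof.
case/set0Pn=> y0; rewrite inE => y0x.
have [y yx y_max] := @arg_maxnP _ y0 (above r ^~ x) (rank r) y0x.
exists y; apply/andP; split=> //; apply/forallP => z.
by apply/negP => /andP[yz /y_max]; rewrite above_rank in yz; lia.
Qed.

End Orderings.

Section Correspondences.

Variables (X : finType) (n : nat).
Implicit Types (u v : profile X n) (G : profile X n -> {set X}).

Lemma mem_transfer G u x y i j :
  balanced G -> strongly_monotone G ->
  immediately_above (u i) y x -> above (u j) x y ->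
  exists v, [/\ transposed y x (u i) (v i),
                forall k, k != i -> k != j -> v k = u k
              & x \in G v -> x \in G u].
Proof.
move=> balG monG imm xy.
have neq_ij : i != j.
  apply: contraTneq xy => <-; case/andP: imm => yx _.
  by rewrite (above_asym yx).
have [sj imm_j lower_j] := lowered_exists xy.
have [ti tr_i] := transposed_exists y x (u i).
have [tj tr_j] := transposed_exists y x sj.
pose w : profile X n := [ffun k => if k == j then sj else u k].
pose v : profile X n :=
  [ffun k => if k == i then ti else if k == j then tj else u k].
have wu k : k != j -> w k = u k by move=> /negbTE kj; rewrite ffunE kj.
have wj : w j = sj by rewrite ffunE eqxx.
have vi : v i = ti by rewrite ffunE eqxx.
have vj : v j = tj by rewrite ffunE eq_sym (negbTE neq_ij) eqxx.
have vu k : k != i -> k != j -> v k = u k.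
  by move=> /negbTE ki /negbTE kj; rewrite ffunE ki kj.
exists v; split => //; first by rewrite vi.
have -> : G v = G w.
  apply: (balG y x w v i j); split; rewrite ?wj ?vi ?vj ?(wu i) //.
  by move=> k ki kj; rewrite vu // wu.
move=> xw; case: lower_j => [eq_sj|raise_j].
  suff -> : u = w by [].
  by apply/ffunP => k; rewrite ffunE; case: eqP => // ->.
apply: (proj1 (monG x j w u xw _ _)); first by rewrite wj.
by move=> k kj; rewrite wu.
Qed.

(** No trade disturbs the later ones: it changes only the ordering of [k], where
    the upper set shrinks, and that of a voter matched with no other
    alternative. *)
Lemma mem_of_distinct_defenders G u x k (f : X -> 'I_n) :
  tops_in G -> balanced G -> strongly_monotone G ->
  {in upper_set (u k) x &, injective f} ->
  {in upper_set (u k) x, forall y, above (u (f y)) x y} ->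
  x \in G u.
Proof.
move=> topG balG monG.
have [c] := ubnP (rank (u k) x); elim: c u => // c IH u le_c f_inj f_def.
have [up0|/upper_set_last[y imm]] := eqVneq (upper_set (u k) x) set0.
  apply: (subsetP (topG u)); rewrite inE; apply/existsP; exists k.
  exact: upper_set0_is_top.
have yx : above (u k) y x by case/andP: imm.
have y_up : y \in upper_set (u k) x by rewrite inE.
have [v [tr vu]] := mem_transfer balG monG imm (f_def y y_up).
have sub := upper_set_transposed yx tr.
have sub_up z : z \in upper_set (v k) x -> z != y /\ z \in upper_set (u k) x.
  by move/(subsetP sub); rewrite in_setD1 => /andP[].
apply; apply: IH.
- have := subset_leq_card sub; move: le_c.
  by rewrite /rank (cardsD1 y (upper_set (u k) x)) y_up; lia.
- by move=> a b /sub_up[_ a_up] /sub_up[_ b_up]; apply: f_inj.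
- move=> z /sub_up[zy z_up]; rewrite vu ?f_def //.
    apply: contraTneq (f_def z z_up) => ->; rewrite inE in z_up.
    by rewrite (above_asym z_up).
  by apply: contra_neq zy; apply: f_inj.
Qed.

Lemma pareto_optimal_defenders u x : 0 < n ->
  x \in pareto_correspondence u ->
  exists f : X -> 'I_n, forall y, y != x -> above (u (f y)) x y.
Proof.
move=> n_gt0; rewrite inE negb_exists => /forallP undom.
exists (fun y => odflt (Ordinal n_gt0) [pick i | above (u i) x y]) => y yx.
case: pickP => [//|none]; case/negP: (undom y); apply/forallP => i.
by have := above_total (u i) yx; rewrite none orbF.
Qed.

End Correspondences.

Theorem theorem3 (X : finType) (n : nat) (G : profile X n -> {set X}) :
  #|X| = 4 ->
  2 <= n ->
  social_choice_correspondence G ->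
  pareto_condition G ->
  tops_in G ->
  balanced G ->
  strongly_monotone G ->
  G =1 @pareto_correspondence X n.
Proof.
move=> card4 n_ge2 _ parG topG balG monG u.
apply/eqP; rewrite eqEsubset; apply/andP; split; apply/subsetP => x.
  move=> xG; rewrite inE; apply/existsP => -[y /parG].
  by rewrite xG.
have n_gt0 : 0 < n by lia.
case/(pareto_optimal_defenders n_gt0) => f f_def.
have up_def k : {in upper_set (u k) x, forall y, above (u (f y)) x y}.
  by move=> y; rewrite inE => /above_neq; apply: f_def.
have [/existsP[k le1]|] := boolP [exists k, rank (u k) x <= 1].
  apply: (mem_of_distinct_defenders topG balG monG _ (up_def k)) => a b a_k b_k _.
  exact: (card_le1_eqP le1).
rewrite negb_exists => /forallP ge2.
apply: (mem_of_distinct_defenders topG balG monG _ (up_def (Ordinal n_gt0))).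
move=> a b a_up b_up eq_f; apply/eqP; apply: contraT => neq_ab.
have xa := up_def _ _ a_up; have xb := up_def _ _ b_up.
rewrite -eq_f in xb; case/negP: (ge2 (f a)).
(* A voter ranking x above both a and b leaves only 4 - 3 alternatives above x. *)
have sub : upper_set (u (f a)) x \subset ~: (x |: [set a; b]).
  apply/subsetP => z; rewrite !inE => zx; rewrite (negbTE (above_neq zx)) /=.
  by apply/norP; split; apply: contraTneq zx => ->; rewrite above_asym.
have := subset_leq_card sub; have := cardsC (x |: [set a; b]).
rewrite cardsU1 cards2 neq_ab !inE card4.
by rewrite (negbTE (above_neq xa)) (negbTE (above_neq xb)) /rank; lia.
Qed.
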